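(* For every integer $n\ge 0$ and every real number $x$, $$B_{n}^{L}(x)=e^{-x}\sum_{k=0}^{\infty}\frac{\langle k\rangle_{n}}{k!}x^{k}.$$
   Context: The rising factorial is $\langle x\rangle_0=1$ and $\langle x\rangle_n=x(x+1)\cdots(x+n-1)$ for $n\ge 1$. For integers $n,k\ge 0$, the unsigned Lah number $L(n,k)$ is the number of ways a set of $n$ elements can be partitioned into $k$ nonempty linearly ordered subsets (so $L(0,0)=1$, $L(n,0)=0$ for $n\ge 1$, $L(n,k)=0$ for $k>n$, and $L(n,k)=\binom{n-1}{k-1}\frac{n!}{k!}$ for $n\ge k\ge 1$). The Lah-Bell polynomials are $B_n^L(x)=\sum_{l=0}^n L(n,l)x^l$ for $n\ge 0$. By convention $x^0=1$. *)

(* Defs.v *)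
From HB Require Import structures.
From mathcomp Require Import all_boot all_order all_algebra.
From mathcomp Require Import all_classical all_reals all_analysis.

Set Implicit Arguments.
Unset Strict Implicit.
Unset Printing Implicit Defensive.

Import Order.TTheory GRing.Theory Num.Theory.
Import numFieldNormedType.Exports.

Local Open Scope ring_scope.

Definition rising_fact (R : pzSemiRingType) (x : R) (n : nat) : R :=
  \prod_(i < n) (x + i%:R).

(* A linearly ordered subset of 'I_n is represented by the duplicate-free
   sequence listing its elements in increasing order; the size bound in
   {bseq n of 'I_n} excludes no such sequence. *)
Definition lah_partition (n k : nat) (P : {set {bseq n of 'I_n}}) : bool :=
  [&& #|P| == k,
      [forall s in P, (s != [::] :> seq 'I_n) && uniq s] &
      [forall i : 'I_n, #|[set s in P | i \in s]| == 1%N]].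

Definition lah (n k : nat) : nat :=
  #|[set P : {set {bseq n of 'I_n}} | lah_partition k P]|.

Definition lah_bell (R : nzSemiRingType) (n : nat) : {poly R} :=
  \sum_(l < n.+1) (lah n l)%:R *: 'X^l.

(* Main.v *)
Require Import Defs.
From HB Require Import structures.
From mathcomp Require Import all_boot all_order all_algebra.
From mathcomp Require Import all_classical all_reals all_analysis.

(** The identity is a Dobinski formula: it follows from expanding the rising
    factorial in falling factorials,
      m (m+1) ... (m+n-1) = \sum_l L(n, l) m (m-1) ... (m-l+1),
    for every natural number m, because the series \sum_k (k)_l / k! x^k of
    a falling factorial (k)_l is just x^l e^x ([cvg_series_ffact]).

    The expansion is proved by counting twice the ways to place n labels in m
    boxes, each box holding a linearly ordered, possibly empty, list of labels
    ([arrangements]).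

    - The nonempty lists of an arrangement form a partition into ordered
      blocks.  Conversely, a given partition P into l blocks arises from as
      many arrangements as there are injections from P to the boxes, namely
      (m)_l ([card_injective_fillings]).  Summing over P gives
      \sum_l L(n, l) (m)_l ([card_arrangements_lah]).
    - Concatenating the lists gives a permutation of the labels, and the
      lengths of the lists give a composition of n into m possibly zero parts;
      these two data determine the arrangement and are arbitrary.  There are
      n! 'C(m+n-1, n) such pairs, which is the rising factorial
      ([card_arrangements_ord]). *)

Set Implicit Arguments.
Unset Strict Implicit.
Unset Printing Implicit Defensive.

Import Order.TTheory GRing.Theory Num.Theory.
Import numFieldNormedType.Exports.

Section Combinatorics.
Local Open Scope nat_scope.

(** * Arrangements sorted by their set of blocks *)

(** A function that takes each value of P exactly once, and the default z
    elsewhere, is the same thing as the injection sending each element of P to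
    the place where it is taken. *)
Lemma card_injective_fillings (A T : finType) (z : T) (P : {set T}) :
  z \notin P ->
  #|[set f : {ffun A -> T} |
      dinjectiveb f [set a | f a != z] && (f @: [set a | f a != z] == P)]|
  = #|A| ^_ #|P|.
Proof.
move=> zP.
pose D : finType := {s : T | s \in P}.
pose F (g : {ffun D -> A}) : {ffun A -> T} :=
  [ffun a => if [pick d | g d == a] is Some d then val d else z].
have nzD (d : D) : val d != z.
  by apply: contraNneq zP => <-; exact: valP.
have FE (g : {ffun D -> A}) d : injective g -> F g (g d) = val d.
  move=> gI; rewrite ffunE; case: pickP => [d' /eqP/gI -> //|/(_ d)].
  by rewrite eqxx.
have FN (g : {ffun D -> A}) a :
    F g a != z -> exists2 d, g d = a & F g a = val d.
  rewrite ffunE; case: pickP => [d /eqP <- _|]; last by rewrite eqxx.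
  by exists d.
have <- : #|{: D}| = #|P| by rewrite card_sig.
rewrite -card_inj_ffuns -(card_in_imset (f := F)); last first.
  move=> g g'; rewrite !inE => /injectiveP gI /injectiveP g'I e.
  apply/ffunP => d; have h : F g (g' d) = val d by rewrite e FE.
  (* F g takes the value val d, which is not z, at g' d; hence g' d = g d' for
     some d', and comparing values gives d' = d. *)
  have [|d' gd'] := FN g (g' d); first by rewrite h nzD.
  by rewrite h -gd' => /val_inj ->.
apply: eq_card => f; rewrite inE.
apply/andP/imsetP => [[/dinjectiveP fI /eqP fP]|].
  have /fin_all_exists[g gE] (d : D) : exists a, f a = val d.
    have : val d \in f @: [set a | f a != z] by rewrite fP; exact: valP.
    by case/imsetP => a _ ->; exists a.
  have gI : injective g by move=> d d' e; apply: val_inj; rewrite -!gE e.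
  exists [ffun d => g d].
    by rewrite inE; apply/injectiveP => d d'; rewrite !ffunE => /gI.
  apply/ffunP => a; rewrite ffunE; case: pickP => [d|no].
    by rewrite ffunE => /eqP <-; rewrite gE.
  apply/eqP; apply: contraT => faz.
  have fa : f a \in P by rewrite -fP; apply/imsetP; exists a; rewrite ?inE.
  (* The value f a would then be taken at a and at the place g assigns to it,
     which differs from a because a is outside the range of g. *)
  have := no (exist _ (f a) fa); rewrite ffunE => /eqP[].
  apply: fI; rewrite ?inE //; by rewrite gE.
case=> g; rewrite inE => /injectiveP gI ->; split.
  apply/dinjectiveP => a a'; rewrite !inE => /FN[d <- ->] /FN[d' <- ->].
  by move/val_inj ->.
apply/eqP/setP => s; apply/imsetP/idP => [[a]|sP].
  by rewrite inE => /FN[d _ ->] ->; exact: valP.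
exists (g (exist _ s sP)); last by rewrite FE.
by rewrite inE FE.
Qed.

(** Counting occurrences with multiplicity expresses at once that the lists
    f a are duplicate-free and that each label lies in exactly one of them.
    The index set D is a set of boxes for an arrangement, and a set of lists,
    with f the identity, for a partition into blocks. *)
Definition covers_once n (A : finType) (D : {pred A})
    (f : A -> {bseq n of 'I_n}) : bool :=
  [forall i, \sum_(a in D) count_mem i (f a) == 1].

Lemma sum_nat1_inj (A : finType) (D : {pred A}) (F : A -> nat) a b :
  \sum_(c in D) F c = 1 -> a \in D -> b \in D ->
  0 < F a -> 0 < F b -> a = b.
Proof.
move=> h aD bD Fa Fb; apply/eqP; apply: contraT => ab.
move: h; rewrite (bigD1 a) //= (bigD1 b) /=; last by rewrite bD eq_sym.
by case: (F a) Fa => // ? _; case: (F b) Fb => // ? _; rewrite addSn addnS.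
Qed.

Lemma lah_partitionE n k (P : {set {bseq n of 'I_n}}) :
  lah_partition k P =
  [&& #|P| == k, [bseq] \notin P & covers_once (mem P) id].
Proof.
rewrite /lah_partition; congr (_ && _).
apply/andP/andP => [[/forallP nu /forallP one]|[nP /forallP one]].
  split.
    by apply/negP => h; have := nu [bseq]; rewrite h.
  apply/forallP => i; rewrite -(eqP (one i)) -sum1_card; apply/eqP.
  rewrite [RHS](eq_bigl (fun s => (s \in P) && (i \in s))); last first.
    by move=> s; rewrite inE.
  rewrite big_mkcondr /=; apply: eq_bigr => s sP.
  have := nu s; rewrite sP => /andP[_ us].
  by rewrite count_uniq_mem //; case: (i \in s).
have le1 s i : s \in P -> count_mem i s = (i \in s).
  move=> sP; have := eqP (one i); rewrite (bigD1 s) //= -has_pred1 has_count.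
  by case: (count_mem i s) => [|[|?]].
split; apply/forallP.
  move=> s; apply/implyP => sP; apply/andP; split; last first.
    by apply: count_mem_uniq => i; exact: le1.
  by apply: contraNneq nP => s0; rewrite (_ : [bseq] = s) //; exact: val_inj.
move=> i; rewrite -(eqP (one i)) -sum1_card; apply/eqP.
rewrite (eq_bigl (fun s => (s \in P) && (i \in s))); last first.
  by move=> s; rewrite inE.
rewrite big_mkcondr /=; apply: eq_bigr => s sP.
by rewrite le1 //; case: (i \in s).
Qed.

Definition arrangements n (A : finType) : {set {ffun A -> {bseq n of 'I_n}}} :=
  [set f : {ffun A -> {bseq n of 'I_n}} | covers_once (mem A) f].

Definition blocks n (A : finType) (f : {ffun A -> {bseq n of 'I_n}}) :
  {set {bseq n of 'I_n}} := f @: [set a | f a != [bseq]].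

(** A repeated nonempty list would repeat its labels, so an arrangement is
    injective outside its empty boxes, and summing over boxes amounts to
    summing over blocks. *)
Lemma arrangements_blocks n (A : finType) (f : {ffun A -> {bseq n of 'I_n}}) :
  (f \in arrangements n A) =
  dinjectiveb f [set a | f a != [bseq]] && covers_once (mem (blocks f)) id.
Proof.
pose S : {set A} := [set a | f a != [bseq]].
have sumS i : \sum_(a in A) count_mem i (f a) = \sum_(a in S) count_mem i (f a).
  rewrite (bigID (mem S)) /= [X in _ + X]big1 ?addn0 // => a.
  by rewrite inE negbK => /eqP ->.
rewrite inE; apply/idP/idP.
- move=> /forallP one.
  have fI : {in S &, injective f}.
    move=> a b; rewrite inE => aS bS ab.
    have [i fi] : exists i, i \in f a.
      case e : (bseqval (f a)) aS => [|i s] aS; last first.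
        by exists i; have : i \in bseqval (f a) by rewrite e mem_head.
      by case/eqP: aS; apply: val_inj.
    apply: (@sum_nat1_inj _ (mem A) (fun a => count_mem i (f a))) => //.
    + exact: eqP (one i).
    + by rewrite -has_count has_pred1.
    + by rewrite -ab -has_count has_pred1.
  apply/andP; split; first exact/dinjectiveP.
  by apply/forallP => i; rewrite big_imset //= -sumS.
- move=> /andP[/dinjectiveP fI /forallP one].
  by apply/forallP => i; rewrite sumS; have := one i; rewrite big_imset.
Qed.

Lemma nil_notin_blocks n (A : finType) (f : {ffun A -> {bseq n of 'I_n}}) :
  [bseq] \notin blocks f.
Proof.
by apply/imsetP => -[a]; rewrite inE => /negP h e; apply: h; rewrite -e.
Qed.

(** The n labels are shared out among nonempty blocks. *)
Lemma lah_partition_le n k (P : {set {bseq n of 'I_n}}) :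
  lah_partition k P -> #|P| <= n.
Proof.
rewrite lah_partitionE => /and3P[_ nP /forallP one].
have h : n = \sum_(s in P) size s.
  rewrite -[LHS]card_ord -sum1_card.
  under eq_bigr => i _ do rewrite -(eqP (one i)).
  rewrite exchange_big /=; apply: eq_bigr => s _.
  rewrite -(sum1_size s) [RHS](partition_big id predT) //=.
  by apply: eq_big => // i _; rewrite sum1_count.
apply: (@leq_trans (\sum_(s in P) size s)); last by rewrite -h.
rewrite -sum1_card; apply: leq_sum => s sP; rewrite lt0n size_eq0.
by apply: contraNneq nP => s0; rewrite (_ : [bseq] = s) //; exact: val_inj.
Qed.

(** First count, by sets of blocks.  Once its blocks form a partition of the
    labels, a function has only to be injective outside its empty boxes to be
    an arrangement, so the fibre over P is counted by injections. *)
Lemma card_arrangements_lah n (A : finType) :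
  #|arrangements n A| = \sum_(l < n.+1) lah n l * #|A| ^_ l.
Proof.
pose lists := {set {bseq n of 'I_n}}.
pose Q := fun P : lists => lah_partition #|P| P.
transitivity (\sum_(P | Q P) #|A| ^_ #|P|).
  rewrite -sum1_card (partition_big (@blocks n A) Q) /=; last first.
    move=> f; rewrite /Q.
    rewrite arrangements_blocks lah_partitionE eqxx nil_notin_blocks.
    by case/andP.
  apply: eq_bigr => P; rewrite /Q lah_partitionE => /and3P[_ nP cP].
  rewrite -(card_injective_fillings A nP) -sum1dep_card; apply: eq_bigl => f.
  rewrite arrangements_blocks -/(blocks f).
  by case: (eqVneq (blocks f) P) => [->|]; rewrite ?cP ?andbT ?andbF.
rewrite (partition_big (fun P : lists => inord #|P| : 'I_n.+1) predT) //=.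
apply: eq_bigr => l _; rewrite /lah -sum1dep_card big_distrl /=.
have E (P : lists) : Q P && (inord #|P| == l) = lah_partition l P.
  apply/andP/idP => [[PP]|lP].
    rewrite -val_eqE /= inordK; first by move/eqP <-.
    by rewrite ltnS; exact: lah_partition_le PP.
  have /andP[/eqP cP _] := lP.
  by rewrite /Q cP; split => //; rewrite inord_val.
by rewrite (eq_bigl _ _ E); apply: eq_bigr => P /andP[/eqP -> _]; rewrite mul1n.
Qed.

(** * Arrangements as a permutation cut into pieces *)

Lemma count_mem1P n (s : seq 'I_n) :
  reflect (uniq s /\ size s = n) [forall i, count_mem i s == 1].
Proof.
apply: (iffP forallP) => [one|[us sz] i].
  have mem_s i : i \in s by rewrite -has_pred1 has_count (eqP (one i)).
  have us : uniq s.
    by apply: count_mem_uniq => i; rewrite (eqP (one i)) mem_s.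
  split=> //; rewrite -(card_uniqP us) -[RHS]card_ord.
  by apply: eq_card => i; rewrite mem_s.
have sub : {subset s <= enum 'I_n} by move=> j _; rewrite mem_enum.
have [|_ ms] := uniq_min_size us sub; first by rewrite size_enum_ord sz.
by rewrite count_uniq_mem // ms mem_enum.
Qed.

Definition rows n m (f : {ffun 'I_m -> {bseq n of 'I_n}}) : seq (seq 'I_n) :=
  [seq bseqval (f j) | j <- enum 'I_m].

Lemma rows_inj n m : injective (@rows n m).
Proof.
move=> f g /eq_in_map fg; apply/ffunP => j; apply: val_inj.
by apply: fg; rewrite mem_enum.
Qed.

Lemma arrangements_rows n m (f : {ffun 'I_m -> {bseq n of 'I_n}}) :
  reflect (uniq (flatten (rows f)) /\ size (flatten (rows f)) = n)
    (f \in arrangements n 'I_m).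
Proof.
rewrite inE (_ : covers_once _ _ =
  [forall i, count_mem i (flatten (rows f)) == 1]); first exact: count_mem1P.
apply: eq_forallb => i; congr (_ == _).
by rewrite count_flatten sumnE !big_map.
Qed.

(** The right-hand side is the rising factorial of m; the truncated
    predecessor makes this hold for m = 0 as well, where both sides are 1 if
    n = 0 and vanish otherwise. *)
Lemma card_weak_compositions n m :
  #|[set c : m.-tuple 'I_n.+1 | \sum_(i <- c) i == n]| * n`! =
  (m + n).-1 ^_ n.
Proof.
case: m => [|m]; last first.
  by rewrite card_ord_partitions -bin_sub ?leq_addr // addKn bin_ffact.
case: n => [|n]; last first.
  rewrite ffact_small // (_ : [set c | _] = finset.set0) ?cards0 //.
  by apply/setP => c; rewrite !inE tuple0 big_nil.
rewrite (_ : [set c | _] = [set: 0.-tuple 'I_1]) ?cardsT ?card_tuple //.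
by apply/setP => c; rewrite !inE tuple0 big_nil.
Qed.

(** Second count: [F] cuts the word p.1 into pieces of lengths p.2, and is
    inverted by taking the concatenation and the lengths of the rows. *)
Lemma card_arrangements_ord n m : #|arrangements n 'I_m| = (m + n).-1 ^_ n.
Proof.
pose F (p : n.-tuple 'I_n * m.-tuple 'I_n.+1) :
    {ffun 'I_m -> {bseq n of 'I_n}} :=
  [ffun j : 'I_m => insub_bseq n (nth [::] (reshape (map val p.2) p.1) j)].
pose T := [set t : n.-tuple 'I_n | all predT t & uniq t].
pose C := [set c : m.-tuple 'I_n.+1 | \sum_(i <- c) i == n].
have sumC c : c \in C -> sumn (map val c) = n.
  by rewrite inE sumnE big_map => /eqP.
have rowsF p : p.2 \in C -> rows (F p) = reshape (map val p.2) p.1.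
  case: p => t c /= cC; set sh := map val c.
  have szr : size (reshape sh t) = m.
    by rewrite size_reshape size_map size_tuple.
  rewrite -[RHS](mkseq_nth [::]) szr /mkseq -val_enum_ord -map_comp.
  apply: eq_map => j /=; rewrite ffunE /insub_bseq val_insubd /= ifT //.
  rewrite -nth_shape reshapeKl ?size_tuple ?sumC //.
  by rewrite (nth_map ord0) ?size_tuple // -ltnS ltn_ord.
have -> : #|arrangements n 'I_m| = #|finset.setX T C|.
  rewrite -(card_in_imset (f := F)) => [|[t c] [t' c']]; last first.
    rewrite !inE /= => /andP[_ cC] /andP[_ c'C] e.
    have : rows (F (t, c)) = rows (F (t', c')) by rewrite e.
    rewrite !rowsF ?inE //= => {}e; congr pair; apply: val_inj => /=.
      have := congr1 flatten e; rewrite !reshapeKr // size_tuple sumC ?inE //.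
    apply: (inj_map val_inj).
    by have := congr1 shape e; rewrite !reshapeKl // size_tuple sumC ?inE //.
  apply: eq_card => f.
  apply/arrangements_rows/imsetP => [[us sz]|[[t c] tc ->]].
    have /eqP szt := sz.
    pose c : m.-tuple 'I_n.+1 := [tuple inord (size (f j)) | j < m].
    have cE : map val c = shape (rows f).
      rewrite /shape -!map_comp; apply: eq_map => j /=.
      by rewrite inordK // ltnS size_bseq.
    have cC : c \in C.
      by rewrite inE -(big_map val predT id) -sumnE cE -size_flatten sz.
    exists (Tuple szt, c); last first.
      by apply: rows_inj; rewrite rowsF //= cE flattenK.
    by rewrite inE /= cC andbT inE all_predT.
  move: tc; rewrite inE /= => /andP[]; rewrite inE => /andP[_ ut] cC.
  by rewrite rowsF //= reshapeKr ?size_tuple ?sumC.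
rewrite cardsX mulnC -card_weak_compositions /T cardsE card_uniq_tuples.
by rewrite card_ord ffactnn.
Qed.

End Combinatorics.

Local Open Scope classical_set_scope.
Local Open Scope ring_scope.

(** * Rising and falling factorials *)

Lemma natr_rising_fact (R : pzSemiRingType) m n :
  (rising_fact m n)%:R = rising_fact (m%:R : R) n.
Proof.
rewrite /rising_fact natr_prod; apply: eq_bigr => i _.
by rewrite natrD natn.
Qed.

Lemma rising_factE m n : rising_fact m n = ((m + n).-1 ^_ n)%N.
Proof.
elim: n => [|n IH]; first by rewrite /rising_fact big_ord0.
rewrite /rising_fact big_ord_recr -/(rising_fact m n) IH natn addnS /=.
case: m {IH} => [|m]; last by rewrite ffactSS mulnC.
by rewrite add0n; case: n => [|n]; rewrite // ffact_small ?mul0r ?ffact_small.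
Qed.

Lemma rising_fact_lah m n :
  rising_fact m n = (\sum_(l < n.+1) lah n l * m ^_ l)%N.
Proof.
rewrite rising_factE -card_arrangements_ord card_arrangements_lah.
by rewrite card_ord.
Qed.

(** * Summation of the series *)

(** Induction on l: since (k+1)_(l+1) / (k+1)! = (k)_l / k!, the shifted series
    for l+1 is x times the series for l, and its term at k = 0 vanishes. *)
Lemma cvg_series_ffact (R : realType) (x : R) l :
  series (fun k => (k ^_ l)%:R / k`!%:R * x ^+ k) @ \oo --> x ^+ l * expR x.
Proof.
elim: l => [|l IH].
  rewrite expr0 mul1r; under eq_fun => k do rewrite ffactn0 mul1r.
  have := @is_cvg_series_exp_coeff R x; rewrite /expR exp_coeffE; exact.
rewrite -cvg_shiftS exprS -mulrA.
set u := (X in X @ \oo --> _).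
suff -> : u = (fun N => x * series (fun k => (k ^_ l)%:R / k`!%:R * x ^+ k) N).
  by apply: cvgM; [exact: cvg_cst | exact: IH].
apply/funext => N; rewrite /u /= /series /=.
rewrite big_nat_recl //= ffact0n !mul0r add0r.
rewrite mulr_sumr; apply: eq_bigr => k _.
rewrite ffactSS factS !natrM exprS invfM [X in X * _]mulrACA.
by rewrite divff ?pnatr_eq0 // mul1r mulrCA.
Qed.

Lemma cvg_series_rising_fact (R : realType) (c : nat -> nat) n (x : R) :
  (forall m, rising_fact m n = \sum_(l < n.+1) c l * m ^_ l)%N ->
  series (fun k => rising_fact (k%:R : R) n / k`!%:R * x ^+ k) @ \oo -->
    (\sum_(l < n.+1) (c l)%:R * x ^+ l) * expR x.
Proof.
move=> cE; rewrite mulr_suml.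
set u := (X in X @ \oo --> _).
suff -> : u = fun N => \sum_(l < n.+1)
    (c l)%:R * series (fun k => (k ^_ l)%:R / k`!%:R * x ^+ k) N.
  apply: cvg_big; first exact: add_continuous.
  move=> l _; rewrite -mulrA.
  by apply: cvgM; [exact: cvg_cst | exact: cvg_series_ffact].
apply/funext => N; rewrite /u /series /=.
under [RHS]eq_bigr => l _ do rewrite mulr_sumr.
rewrite exchange_big /=; apply: eq_bigr => k _.
rewrite -natr_rising_fact cE natr_sum !mulr_suml; apply: eq_bigr => l _.
by rewrite natrM !mulrA.
Qed.

Theorem theorem6 (R : realType) (n : nat) (x : R) :
  cvgn (series (fun k : nat => rising_fact (k%:R : R) n / k`!%:R * x ^+ k)) /\
  (lah_bell R n).[x] =
    expR (- x) *
    limn (series (fun k : nat => rising_fact (k%:R : R) n / k`!%:R * x ^+ k)).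
Proof.
have cv := @cvg_series_rising_fact R (lah n) n x (fun m => rising_fact_lah m n).
split; first exact: cvgP cv.
rewrite (cvg_lim _ cv) // mulrC -mulrA expRxMexpNx_1 mulr1.
rewrite /lah_bell horner_sum; apply: eq_bigr => l _.
by rewrite hornerZ hornerXn.
Qed.
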